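(* Let $E, F$ be Riesz spaces and $S,T \in \mathcal{O}(E,F)$. If for every $x \in E$ the supremum $R(x) := \sup \{S(u) + T(v): \, x = u \sqcup v\}$ exists in $F$, then $S \vee T$ exists in $\mathcal{O}(E,F)$ and $S \vee T = R$. Moreover, in the case of existence (of the suprema $R(x)$ for all $x\in E$) the following hold. (1) If $S,T \in \mathcal{P}(E,F)$ then $S \vee T \in \mathcal{P}(E,F)$. (2) If $S,T \in \mathcal{U}(E,F)$ then $S \vee T \in \mathcal{U}(E,F)$.
   Context: A Riesz space is a real vector lattice (no Dedekind completeness or Archimedean property is assumed); $x \perp y$ (disjointness) means $|x| \wedge |y| = 0$. The notation $x = u \sqcup v$ means $x = u + v$ and $u \perp v$; the supremum is over all such pairs $u,v\in E$. An element $x$ is a fragment of $y$, written $x \sqsubseteq y$, if $x \perp y - x$; $\mathfrak{F}_e$ is the set of all fragments of $e$. A function $T \colon E \to F$ is an orthogonally additive operator (OAO) if $T(x+y) = T(x) + T(y)$ for all disjoint $x,y \in E$. $\mathcal{O}(E,F)$ is the vector space of all OAOs, ordered by $S \le T$ iff $S(x) \le T(x)$ for all $x \in E$; $S \vee T$ denotes the least upper bound of $S,T$ in this ordered vector space. $\mathcal{P}(E,F)$ is the set of laterally-to-order bounded OAOs, i.e. those $T$ for which $T(\mathfrak{F}_e)$ is order bounded in $F$ for every $e \in E$. $\mathcal{U}(E,F)$ is the set of order bounded OAOs (abstract Uryson operators), i.e. those sending order bounded subsets of $E$ to order bounded subsets of $F$. *)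

(* Defs.v *)
From HB Require Import structures.
From mathcomp Require Import all_boot all_order all_algebra.
From mathcomp Require Import boolp classical_sets functions reals.
Set Implicit Arguments.
Unset Strict Implicit.
Unset Printing Implicit Defensive.
Import Order.TTheory GRing.Theory Num.Theory.
Local Open Scope classical_set_scope.
Local Open Scope ring_scope.

HB.mixin Record Lmodule_isOrdered (R : realType) V
    of GRing.Lmodule R V & Order.POrder ring_display V := {
  ordv_lerD2r : forall x y z : V, x <= y -> x + z <= y + z;
  ordv_lerZ : forall (a : R) (x y : V), 0 <= a -> x <= y -> a *: x <= a *: y
}.

#[short(type="orderedVectType")]
HB.structure Definition OrderedVectorSpace (R : realType) :=
  { V of GRing.Lmodule R V & Order.POrder ring_display V
       & Lmodule_isOrdered R V }.

(* Order.Lattice is not joined with vector spaces directly: Hierarchy Builder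
   refuses that join, as it would have to be declared before Num.RealDomain.
   The lattice instance on Riesz spaces is declared just after instead. *)
HB.mixin Record OrderedVectorSpace_isRiesz (R : realType) V
    of OrderedVectorSpace R V := {
  riesz_meet : V -> V -> V;
  riesz_join : V -> V -> V;
  riesz_meetP : forall x y z : V,
    (x <= riesz_meet y z) = (x <= y) && (x <= z);
  riesz_joinP : forall x y z : V,
    (riesz_join x y <= z) = (x <= z) && (y <= z)
}.

#[short(type="rieszType")]
HB.structure Definition RieszSpace (R : realType) :=
  { V of OrderedVectorSpace_isRiesz R V & OrderedVectorSpace R V }.

HB.instance Definition _ (R : realType) (V : rieszType R) :=
  Order.POrder_MeetJoin_isLattice.Build ring_display (RieszSpace.sort V)
    riesz_meetP riesz_joinP.

Section Riesz.
Context {R : realType} {E : rieszType R}.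
Implicit Types x y u v e : E.

Definition rabs x : E := Order.join x (- x).

Definition disj x y : Prop := Order.meet (rabs x) (rabs y) = 0.

(* x = u \sqcup v *)
Definition disj_sum x u v : Prop := x = u + v /\ disj u v.

Definition fragment x y : Prop := disj x (y - x).

Definition fragments e : set E := [set x | fragment x e].

Definition order_bounded (A : set E) : Prop := has_lbound A /\ has_ubound A.

End Riesz.

Section OAO.
Context {R : realType} (E F : rieszType R).

Definition orth_additive (T : E -> F) : Prop :=
  forall x y, disj x y -> T (x + y) = T x + T y.

Definition oao_pred : {pred E -> F} := [pred T | `[< orth_additive T >]].

Record oao := OAO { oao_fun :> E -> F; _ : oao_fun \in oao_pred }.

HB.instance Definition _ := [isSub for oao_fun].
HB.instance Definition _ := [Choice of oao by <:].

Lemma oao_submod_closed : submod_closed oao_pred.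
Proof.
split=> [|a S T /asboolP hS /asboolP hT]; apply/asboolP => x y xy.
  by rewrite [RHS]addr0.
rewrite [LHS](_ : _ = a *: S (x + y) + T (x + y))// (hS _ _ xy) (hT _ _ xy).
by rewrite scalerDr addrACA.
Qed.

HB.instance Definition _ :=
  GRing.isSubmodClosed.Build R (E -> F) oao_pred oao_submod_closed.
HB.instance Definition _ := [SubChoice_isSubLmodule of oao by <:].

(* The order is the restriction of the pointwise order on functions. *)
HB.instance Definition _ :=
  [SubChoice_isSubPOrder of oao by <: with ring_display].

Lemma oao_leP (S T : oao) : reflect (forall x, S x <= T x) (S <= T).
Proof. exact: lefP. Qed.

Fact oao_lerD2r (S T U : oao) : S <= T -> S + U <= T + U.
Proof. by move=> /oao_leP ST; apply/oao_leP => x; exact: ordv_lerD2r. Qed.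

Fact oao_lerZ (a : R) (S T : oao) : 0 <= a -> S <= T -> a *: S <= a *: T.
Proof. by move=> a0 /oao_leP ST; apply/oao_leP => x; exact: ordv_lerZ. Qed.

HB.instance Definition _ :=
  Lmodule_isOrdered.Build R oao oao_lerD2r oao_lerZ.

End OAO.

Notation "{ 'oao' E -> F }" := (oao E F)
  (at level 0, E at level 98, F at level 99, format "{ 'oao'  E  ->  F }")
  : type_scope.

Section Classes.
Context {R : realType} {E F : rieszType R}.

(* \mathcal{P}(E,F) *)
Definition laterally_bounded : set {oao E -> F} :=
  [set T : {oao E -> F} | forall e, order_bounded (T @` fragments e)].

(* \mathcal{U}(E,F) *)
Definition uryson : set {oao E -> F} :=
  [set T : {oao E -> F} |
    forall A : set E, order_bounded A -> order_bounded (T @` A)].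

(* The values whose supremum is R(x). *)
Definition split_values (S T : E -> F) (x : E) : set F :=
  [set r | exists u v, disj_sum x u v /\ r = S u + T v].

End Classes.

(* Main.v *)
(* If x = u + v with u and v disjoint, then |u| <= |x|, so splittings of two
   disjoint elements x and y add up to a splitting of x + y and
   R x + R y <= R (x + y).  Conversely every splitting x + y = u + v arises in
   this way: it has a common refinement with x + y, in which the common fragment
   of x and u is (x^+ /\ u^+) - (x^- /\ u^-).  So R is orthogonally additive.
   It dominates S and T by the splittings x + 0 and 0 + x, and is dominated by
   every orthogonally additive U above S and T, as U u + U v = U x. *)
Require Import Defs.
From HB Require Import structures.
From mathcomp Require Import all_boot all_order all_algebra.
From mathcomp Require Import boolp classical_sets functions reals.
Set Implicit Arguments.
Unset Strict Implicit.
Unset Printing Implicit Defensive.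
Import Order.TTheory GRing.Theory Num.Theory.
Local Open Scope classical_set_scope.
Local Open Scope ring_scope.

Section RieszTheory.
Context {R : realType} {E : rieszType R}.
Implicit Types a b c x y z u v e : E.

(** * Translation rules for the order, joins and meets *)

Lemma ordv_leD2r z x y : (x + z <= y + z) = (x <= y).
Proof.
apply/idP/idP => [|/ordv_lerD2r//].
by move=> /(@ordv_lerD2r _ _ _ _ (- z)); rewrite !addrK.
Qed.

Lemma ordv_leD2l z x y : (z + x <= z + y) = (x <= y).
Proof. by rewrite ![z + _]addrC ordv_leD2r. Qed.

Lemma ordv_leD x y z t : x <= y -> z <= t -> x + z <= y + t :> E.
Proof.
move=> xy zt; apply: (@le_trans _ _ (y + z)).
  by rewrite ordv_leD2r.
by rewrite ordv_leD2l.
Qed.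

Lemma ordv_leBlDr x y z : (x - y <= z) = (x <= z + y).
Proof. by rewrite -[LHS](ordv_leD2r y) subrK. Qed.

Lemma ordv_leBrDr x y z : (x <= y - z) = (x + z <= y).
Proof. by rewrite -[LHS](ordv_leD2r z) subrK. Qed.

Lemma ordv_leN2 x y : (- x <= - y) = (y <= x).
Proof. by rewrite -[LHS](ordv_leD2r (x + y)) addKr [x + y]addrC addKr. Qed.

Lemma ordv_leNl x y : (- x <= y) = (- y <= x).
Proof. by rewrite -[LHS]ordv_leN2 opprK. Qed.

Lemma ordv_leB2 x y : 0 <= y -> x - y <= x.
Proof. by move=> y0; rewrite ordv_leBlDr -[leLHS]addr0 ordv_leD2l. Qed.

Lemma ordv_leDl x y : 0 <= y -> x <= x + y.
Proof. by move=> y0; rewrite -[leLHS]addr0 ordv_leD2l. Qed.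

Lemma ordv_addr_ge0 x y : 0 <= x -> 0 <= y -> 0 <= x + y.
Proof. by move=> x0 y0; rewrite (le_trans x0)// ordv_leDl. Qed.

Lemma riesz_joinDr z x y : Order.join (x + z) (y + z) = Order.join x y + z.
Proof.
apply/le_anti/andP; split; first by rewrite leUx !ordv_leD2r leUl leUr.
by rewrite -ordv_leBrDr leUx !ordv_leBrDr leUl leUr.
Qed.

Lemma riesz_oppI x y : - Order.meet x y = Order.join (- x) (- y).
Proof.
apply/le_anti/andP; split; last by rewrite leUx !ordv_leN2 leIl leIr.
by rewrite ordv_leNl lexI ordv_leNl leUl ordv_leNl leUr.
Qed.

(** Negation turns the meet into the join of [- x] and [- y], and translating by [x + y] exchanges
    the two arguments. For disjoint positive elements it makes the join equal to the sum. *)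
Lemma riesz_joinE x y : Order.join x y = x + y - Order.meet x y.
Proof.
rewrite riesz_oppI addrC -riesz_joinDr addKr joinC.
by rewrite [x + y]addrC addKr.
Qed.

Lemma riesz_meetDr z x y : Order.meet (x + z) (y + z) = Order.meet x y + z.
Proof.
apply: oppr_inj; rewrite opprD !riesz_oppI -riesz_joinDr.
by rewrite !opprD.
Qed.

Lemma riesz_meet_subadd a b c : 0 <= a -> 0 <= b -> 0 <= c ->
  Order.meet a (b + c) <= Order.meet a b + Order.meet a c.
Proof.
(* With [m] the meet on the left, subtracting [Order.meet a c] from [m] gives the join of [m - a]
   and [m - c]; each of these is compared with [a] and with [b]. *)
move=> a0 b0 c0; rewrite -ordv_leBlDr riesz_oppI addrC -riesz_joinDr leUx.
rewrite ![- _ + _]addrC !lexI !ordv_leBlDr leIr andbT.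
by rewrite !(le_trans (leIl _ _))// ?ordv_leDl// [b + a]addrC ordv_leDl.
Qed.

Lemma riesz_meet_ge0 a b : 0 <= a -> 0 <= b -> 0 <= Order.meet a b.
Proof. by move=> a0 b0; rewrite lexI a0. Qed.

Lemma riesz_meet0_le a b c d : 0 <= a -> 0 <= c -> a <= b -> c <= d ->
  Order.meet b d = 0 -> Order.meet a c = 0.
Proof.
move=> a0 c0 ab cd bd; apply/le_anti; rewrite riesz_meet_ge0// andbT -bd.
by rewrite leI2.
Qed.

Lemma riesz_meet0D a b c : 0 <= a -> 0 <= b -> 0 <= c ->
  Order.meet a b = 0 -> Order.meet a c = 0 -> Order.meet a (b + c) = 0.
Proof.
move=> a0 b0 c0 ab ac; apply/le_anti.
rewrite riesz_meet_ge0 ?ordv_addr_ge0// andbT.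
by rewrite (le_trans (riesz_meet_subadd _ _ _))// ab ac addr0.
Qed.

(** The two meets on the right are disjoint, so their sum is their join, which lies below both [a]
    and [b + c]. *)
Lemma riesz_meetD a b c : 0 <= a -> 0 <= b -> 0 <= c -> Order.meet b c = 0 ->
  Order.meet a (b + c) = Order.meet a b + Order.meet a c.
Proof.
move=> a0 b0 c0 bc; apply/le_anti; rewrite riesz_meet_subadd//=.
have := riesz_joinE (Order.meet a b) (Order.meet a c).
rewrite (riesz_meet0_le _ _ (leIr _ _) (leIr _ _) bc) ?riesz_meet_ge0// subr0.
move=> <-; rewrite leUx !lexI !leIl /= (le_trans (leIr _ _)) ?ordv_leDl//=.
by rewrite (le_trans (leIr _ _))// addrC ordv_leDl.
Qed.

(** * Positive parts, negative parts [rpos (- x)] and absolute values *)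

Definition rpos x : E := Order.join x 0.

Lemma rpos_ge0 x : 0 <= rpos x. Proof. exact: leUr. Qed.
Hint Resolve rpos_ge0 : core.

Lemma rposB x : rpos x - rpos (- x) = x.
Proof.
rewrite /rpos -{2}oppr0 -riesz_oppI opprK riesz_joinE.
by rewrite subrK addr0.
Qed.

Lemma rpos_meetN x : Order.meet (rpos x) (rpos (- x)) = 0.
Proof.
have -> : rpos x = x + rpos (- x) by rewrite -{2}(rposB x) subrK.
rewrite -{2}[rpos (- x)]add0r riesz_meetDr /rpos.
by rewrite -{2}oppr0 -riesz_oppI subrr.
Qed.

(** Uniqueness of the decomposition into disjoint positive and negative parts: the join of [a - b]
    and [0] is the join of [a] and [b] minus [b], and that join is [a + b]. *)
Lemma rpos_sub_disj a b : Order.meet a b = 0 -> rpos (a - b) = a.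
Proof.
move=> ab0; rewrite /rpos -(subrr b) riesz_joinDr riesz_joinE ab0 subr0.
by rewrite addrK.
Qed.

Lemma rabsN x : rabs (- x) = rabs x.
Proof. by rewrite /rabs opprK joinC. Qed.

Lemma rabs_le x c : (rabs x <= c) = (x <= c) && (- x <= c).
Proof. exact: leUx. Qed.

Lemma ler_rabs x : x <= rabs x. Proof. exact: leUl. Qed.

Lemma rabs_ge0 x : 0 <= rabs x.
Proof.
(* Twice the absolute value dominates [x - x]; scaling by one half then gives the claim. *)
have h : 0 <= rabs x + rabs x.
  by rewrite -(subrr x) ordv_leD// ?ler_rabs// -rabsN ler_rabs.
have := @ordv_lerZ _ _ 2^-1 _ _ _ h; rewrite invr_ge0 ler0n => /(_ isT).
by rewrite scaler0 -mulr2n -scaler_nat scalerA mulVf ?scale1r// pnatr_eq0.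
Qed.
Hint Resolve rabs_ge0 : core.

Lemma rpos_le_rabs x : rpos x <= rabs x.
Proof. by rewrite leUx ler_rabs rabs_ge0. Qed.

Lemma rneg_le_rabs x : rpos (- x) <= rabs x.
Proof. by rewrite -rabsN rpos_le_rabs. Qed.

Lemma rabsE x : rabs x = rpos x + rpos (- x).
Proof.
apply/le_anti; rewrite rabs_le (le_trans (leUl _ _) (ordv_leDl _ _))//=.
rewrite addrC (le_trans (leUl _ _) (ordv_leDl _ _))//= addrC.
have := riesz_joinE (rpos x) (rpos (- x)); rewrite rpos_meetN subr0 => <-.
by rewrite leUx rpos_le_rabs rneg_le_rabs.
Qed.

Lemma rabsD x y : rabs (x + y) <= rabs x + rabs y.
Proof. by rewrite rabs_le opprD !ordv_leD ?ler_rabs// -rabsN ler_rabs. Qed.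

Lemma rabs0 : rabs (0 : E) = 0.
Proof. by rewrite /rabs oppr0 joinxx. Qed.

(** * Disjointness and disjoint sums *)

Lemma disj_sym x y : disj x y -> disj y x.
Proof. by rewrite /disj meetC. Qed.

Lemma disjx0 x : disj x 0.
Proof. by rewrite /disj rabs0; apply: meet_r. Qed.

Lemma disj_le x y u v : rabs u <= rabs x -> rabs v <= rabs y ->
  disj x y -> disj u v.
Proof. exact: riesz_meet0_le. Qed.

Lemma disjDr x y z : disj x y -> disj x z -> disj x (y + z).
Proof.
move=> xy xz; apply: (riesz_meet0_le _ _ (lexx (rabs x)) (rabsD y z)) => //.
exact: riesz_meet0D.
Qed.

Lemma disjNN x y : disj x y -> disj (- x) (- y).
Proof. by rewrite /disj !rabsN. Qed.

Lemma disj_rpos x y : disj x y -> Order.meet (rpos x) (rpos y) = 0.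
Proof. by apply: riesz_meet0_le; rewrite ?rpos_le_rabs. Qed.

(** The sum of the positive parts and the sum of the negative parts are disjoint, and their
    difference is [x + y], so [rpos_sub_disj] identifies the former. *)
Lemma rposD x y : disj x y -> rpos (x + y) = rpos x + rpos y.
Proof.
move=> xy; have -> : x + y = rpos x + rpos y - (rpos (- x) + rpos (- y)).
  by rewrite opprD addrACA !rposB.
have xy' : disj x (- y) by rewrite /disj rabsN.
have yx' : disj y (- x) by rewrite /disj rabsN; exact: disj_sym.
apply: rpos_sub_disj; rewrite meetC.
apply: riesz_meet0D; rewrite ?ordv_addr_ge0//.
- by rewrite meetC; apply: riesz_meet0D; rewrite ?rpos_meetN ?disj_rpos.
- by rewrite meetC; apply: riesz_meet0D; rewrite ?rpos_meetN ?disj_rpos.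
Qed.

Lemma rabs_disjD x y : disj x y -> rabs (x + y) = rabs x + rabs y.
Proof.
move=> xy; rewrite !rabsE opprD !rposD//; first by rewrite addrACA.
exact: disjNN.
Qed.

Lemma disj_sumC x u v : disj_sum x u v -> disj_sum x v u.
Proof. by case=> -> uv; split; [rewrite addrC | exact: disj_sym]. Qed.

Lemma disj_sum_rabs x u v : disj_sum x u v -> rabs u <= rabs x.
Proof. by case=> -> uv; rewrite rabs_disjD// ordv_leDl. Qed.

Lemma disj_sumx0 x : disj_sum x x 0.
Proof. by split; [rewrite addr0 | exact: disjx0]. Qed.

(** Here [e - u] is [(e - x) + v], and [u] is disjoint from both terms, from the first because
    [rabs u <= rabs x]. *)
Lemma disj_sum_fragment e x u v :
  fragment x e -> disj_sum x u v -> fragment u e.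
Proof.
move=> xe xuv; have ux := disj_sum_rabs xuv.
case: xuv => xE uv; rewrite /fragment.
rewrite -(subrK x e) -addrA {2}xE [u + v]addrC addrK.
by apply: disjDr => //; exact: disj_le ux (lexx _) xe.
Qed.

(** A piece of [x] is disjoint from every piece of [y], being dominated by [x] in absolute value.
    The first two conclusions are what lets [S] and [T] split over the combined pieces. *)
Lemma disj_sumD x y u1 v1 u2 v2 : disj x y ->
  disj_sum x u1 v1 -> disj_sum y u2 v2 ->
  [/\ disj u1 u2, disj v1 v2 & disj_sum (x + y) (u1 + u2) (v1 + v2)].
Proof.
move=> xy h1 h2; have [u1x u2y] := (disj_sum_rabs h1, disj_sum_rabs h2).
have [v1x v2y] := (disj_sum_rabs (disj_sumC h1), disj_sum_rabs (disj_sumC h2)).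
case: h1 h2 => [-> uv1] [-> uv2] in xy u1x v1x u2y v2y *.
split; [exact: disj_le xy|exact: disj_le xy|split; first by rewrite addrACA].
apply/disj_sym/disjDr; apply/disj_sym/disjDr => //.
- exact: disj_le u1x v2y xy.
- by apply: disj_le u2y v1x _; exact: disj_sym.
Qed.

(** * Common fragments and the refinement of two disjoint sums *)

Definition common_fragment x u : E :=
  Order.meet (rpos x) (rpos u) - Order.meet (rpos (- x)) (rpos (- u)).

Lemma common_fragmentC x u : common_fragment x u = common_fragment u x.
Proof. by congr (_ - _); rewrite meetC. Qed.

Lemma rabs_common_fragment x u : rabs (common_fragment x u) <= rabs x.
Proof.
rewrite rabs_le opprB !(le_trans (ordv_leB2 _ (riesz_meet_ge0 _ _)))//.
  by rewrite (le_trans (leIl _ _))// rneg_le_rabs.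
by rewrite (le_trans (leIl _ _))// rpos_le_rabs.
Qed.

(** Positive and negative parts are additive on disjoint elements, and a meet distributes over a sum
    of disjoint positive elements. *)
Lemma common_fragmentD x u v : disj u v ->
  common_fragment x (u + v) = common_fragment x u + common_fragment x v.
Proof.
move=> uv; have nuv := disjNN uv; rewrite /common_fragment opprD !rposD//.
by rewrite !riesz_meetD ?(disj_rpos uv, disj_rpos nuv)// opprD addrACA.
Qed.

Lemma common_fragment_disjD x y : disj x y -> common_fragment x (x + y) = x.
Proof.
move=> xy; have nxy := disjNN xy; rewrite /common_fragment opprD !rposD//.
by rewrite !meet_l ?ordv_leDl// rposB.
Qed.

(** The equation expresses that [x] is absorbed by [u + v], as any fragment of it is. Additivity
    then splits [x], and the two pieces are disjoint because [u] and [v] dominate them in absolute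
    value. *)
Lemma disj_sum_common_fragment x u v : disj u v ->
    common_fragment x (u + v) = x ->
  disj_sum x (common_fragment x u) (common_fragment x v).
Proof.
move=> uv xE; split; first by rewrite -common_fragmentD.
by apply: disj_le uv; rewrite common_fragmentC rabs_common_fragment.
Qed.

Lemma disj_sum_refine x y u v : disj x y -> disj_sum (x + y) u v ->
  exists u1 u2 v1 v2, [/\ disj_sum u u1 u2, disj_sum v v1 v2,
    disj_sum x u1 v1 & disj_sum y u2 v2].
Proof.
move=> xy [xyE uv].
(* The four pieces form a two by two matrix whose rows sum to [u] and [v] and whose columns sum to
   [x] and [y]. *)
exists (common_fragment u x), (common_fragment u y).
exists (common_fragment v x), (common_fragment v y).
split.
- by apply: disj_sum_common_fragment; rewrite // xyE common_fragment_disjD.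
- apply: disj_sum_common_fragment; rewrite // xyE addrC common_fragment_disjD//.
  exact: disj_sym.
- rewrite ![common_fragment _ x]common_fragmentC.
  by apply: disj_sum_common_fragment; rewrite // -xyE common_fragment_disjD.
- rewrite ![common_fragment _ y]common_fragmentC.
  apply: disj_sum_common_fragment => //.
  rewrite -xyE addrC common_fragment_disjD//.
  exact: disj_sym.
Qed.

(** * Order boundedness in terms of the absolute value *)

Lemma order_bounded_rabs c : order_bounded [set x | rabs x <= c].
Proof.
split; [exists (- c) | exists c] => x /=; rewrite rabs_le => /andP[] // _.
by rewrite -[x in _ -> _ <= x]opprK ordv_leN2.
Qed.

Lemma order_bounded_rabsP (A : set E) : order_bounded A ->
  exists c, A `<=` [set x | rabs x <= c].
Proof.
case=> -[a lba] [b ubb]; exists (Order.join b (- a)) => x Ax /=.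
rewrite rabs_le (le_trans (ubb _ Ax)) ?leUl//=.
by rewrite (le_trans _ (leUr _ _))// ordv_leN2 lba.
Qed.

End RieszTheory.

(** * Elementary rules for orthogonally additive operators *)

Section OAOTheory.
Context {R : realType} {E F : rieszType R}.
Implicit Types S T U : {oao E -> F}.

Lemma oaoD T x y : disj x y -> T (x + y) = T x + T y.
Proof. by have /asboolP := valP T; apply. Qed.

Lemma oao_disj_sum T x u v : disj_sum x u v -> T x = T u + T v.
Proof. by case=> -> /oaoD. Qed.

Lemma oao0 T : T 0 = 0.
Proof.
by apply: (addrI (T 0)); rewrite addr0 -oaoD ?addr0//; exact: disjx0.
Qed.

End OAOTheory.

(** * The operator given by suprema over splittings *)

Section SplitSup.
Context {R : realType} {E F : rieszType R}.
Context (S T : {oao E -> F})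
  (supE : forall x : E, supremums (split_values S T x) !=set0).

Definition split_sup (x : E) : F := supremum 0 (split_values S T x).

Lemma split_sup_supremums x : supremums (split_values S T x) (split_sup x).
Proof.
(* [supremum] returns its default [0] on the empty set; the splitting [x + 0] rules this case
   out. *)
rewrite /split_sup /supremum; case: ifPn => [/eqP A0|_].
  have : split_values S T x (S x + T 0).
    by exists x, 0; split => //; exact: disj_sumx0.
  by rewrite A0.
exact: xgetPex (supE x).
Qed.

Lemma split_sup_ge x u v : disj_sum x u v -> S u + T v <= split_sup x.
Proof.
by move=> xuv; apply: (split_sup_supremums x).1; exists u, v.
Qed.

Lemma split_sup_le x c : (forall u v, disj_sum x u v -> S u + T v <= c) ->
  split_sup x <= c.
Proof.
by move=> h; apply: (split_sup_supremums x).2 => _ [u [v [xuv ->]]]; exact: h.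
Qed.

Lemma split_sup_orth_additive : orth_additive split_sup.
Proof.
move=> x y xy; apply/le_anti/andP; split.
  apply: split_sup_le => u v /(disj_sum_refine xy)[u1 [u2 [v1 [v2 []]]]].
  move=> /oao_disj_sum-> /oao_disj_sum-> xuv yuv; rewrite addrACA.
  by apply: ordv_leD; exact: split_sup_ge.
(* The two suprema are eliminated one at a time, the other summand being moved to the right-hand
   side each time. *)
rewrite -ordv_leBrDr; apply: split_sup_le => u1 v1 xuv.
rewrite ordv_leBrDr addrC -ordv_leBrDr; apply: split_sup_le => u2 v2 yuv.
have [u12 v12 xyuv] := disj_sumD xy xuv yuv.
rewrite ordv_leBrDr addrC addrACA -!oaoD//; exact: split_sup_ge.
Qed.

Definition split_sup_oao : {oao E -> F} :=
  OAO (introT (asboolP _) split_sup_orth_additive).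

Lemma split_sup_geL x : S x <= split_sup x.
Proof.
by rewrite -[leLHS]addr0 -(oao0 T) split_sup_ge//; exact: disj_sumx0.
Qed.

Lemma split_sup_geR x : T x <= split_sup x.
Proof.
rewrite -[leLHS]add0r -(oao0 S) split_sup_ge//; apply: disj_sumC.
exact: disj_sumx0.
Qed.

Lemma split_sup_join : supremums [set S; T] split_sup_oao.
Proof.
split=> [U [] ->|U ubU].
- by apply/oao_leP => x; exact: split_sup_geL.
- by apply/oao_leP => x; exact: split_sup_geR.
have /oao_leP SU : S <= U by apply: ubU; left.
have /oao_leP TU : T <= U by apply: ubU; right.
apply/oao_leP => x; apply: split_sup_le => u v /oao_disj_sum->.
exact: ordv_leD.
Qed.

(** Common core of both boundedness claims: [B] holds all pieces of elements of [A]. A lower bound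
    comes from [S], which lies below the supremum, and an upper bound is the sum of those for [S]
    and [T]. *)
Lemma split_sup_order_bounded (A B : set E) :
    A `<=` B -> (forall x u v, A x -> disj_sum x u v -> B u) ->
  order_bounded (S @` B) -> order_bounded (T @` B) ->
  order_bounded (split_sup @` A).
Proof.
move=> AB splitB [[a lba] [b ubb]] [_ [c ubc]]; split.
  exists a => _ [x Ax <-]; apply: le_trans (split_sup_geL x).
  by apply: lba; exists x => //; exact: AB.
exists (b + c) => _ [x Ax <-]; apply: split_sup_le => u v xuv.
apply: ordv_leD; [apply: ubb; exists u|apply: ubc; exists v] => //.
  exact: splitB xuv.
exact: splitB (disj_sumC xuv).
Qed.

Lemma split_sup_laterally_bounded :
  laterally_bounded S -> laterally_bounded T -> laterally_bounded split_sup_oao.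
Proof.
(* Both [A] and [B] are [fragments e], which is closed under taking pieces. *)
move=> Sb Tb e; apply: split_sup_order_bounded (Sb e) (Tb e) => //.
by move=> x u v; exact: disj_sum_fragment.
Qed.

Lemma split_sup_uryson : uryson S -> uryson T -> uryson split_sup_oao.
Proof.
(* [A] is enlarged to the set of all [x] with [rabs x <= c], which is order bounded and contains the
   pieces of its elements. *)
move=> Sb Tb A /order_bounded_rabsP[c Ac].
have cb := order_bounded_rabs c.
apply: split_sup_order_bounded (Ac) _ (Sb _ cb) (Tb _ cb).
by move=> x u v /Ac xc /disj_sum_rabs ux; exact: le_trans xc.
Qed.

End SplitSup.

Theorem theorem3p2 (R : realType) (E F : rieszType R) (S T : {oao E -> F})
    (supE : forall x : E, supremums (split_values S T x) !=set0) :
  exists W : {oao E -> F},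
    [/\ supremums [set S; T] W,
        forall x : E, W x = supremum 0 (split_values S T x),
        laterally_bounded S -> laterally_bounded T -> laterally_bounded W
      & uryson S -> uryson T -> uryson W].
Proof.
exists (split_sup_oao supE); split=> //; first exact: split_sup_join.
- exact: split_sup_laterally_bounded.
- exact: split_sup_uryson.
Qed.
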